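(* Let $a,b,c,d\in\mathbb{C}$ with $ad-bc=1$ and $a+d=\pm 2$, and let $g(z)=\frac{az+b}{cz+d}$ be the corresponding parabolic Möbius map on $\hat{\mathbb{C}}=\mathbb{C}\cup\{\infty\}$. Then the difference equation $b_{n+1}=g(b_n)$, $n\in\mathbb{N}_0$, has no Hyers-Ulam stability, whatever the initial point $b_0\in\mathbb{C}$. Explicitly: there exists $\delta>0$ such that for every $\varepsilon>0$ there is a sequence $\{a_n\}_{n\in\mathbb{N}_0}$ in $\mathbb{C}$ with $g(a_n)\neq\infty$ and $|a_{n+1}-g(a_n)|\le\varepsilon$ for all $n\in\mathbb{N}_0$ such that, for every $b_0\in\mathbb{C}$, the sequence defined by $b_{n+1}=g(b_n)$ ($n\in\mathbb{N}_0$) satisfies $|a_n-b_n|>\delta$ for some $n\in\mathbb{N}$.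
   Context: $\mathbb{N}=\{1,2,\dots\}$, $\mathbb{N}_0=\mathbb{N}\cup\{0\}$. If $c\ne 0$ then $g(\infty)=a/c$ and $g(-d/c)=\infty$; if $c=0$ then $g(\infty)=\infty$. The solution $\{b_n\}$ is computed in $\hat{\mathbb{C}}$, and $|a_n-b_n|$ is understood to be $+\infty$ if $b_n=\infty$. Hyers-Ulam stability: the difference equation $b_{n+1}=g(b_n)$ has Hyers-Ulam stability if there is $K(\varepsilon)$ with $K(\varepsilon)\to 0$ as $\varepsilon\to 0$ such that for every $\varepsilon>0$ and every complex sequence $\{a_n\}_{n\in\mathbb{N}_0}$ with $|a_{n+1}-g(a_n)|\le\varepsilon$ for all $n\in\mathbb{N}_0$ (with $a_n$ such that $g(a_n)\neq\infty$) there is a sequence $\{b_n\}_{n\in\mathbb{N}_0}$ with $b_{n+1}=g(b_n)$ for all $n\in\mathbb{N}_0$ and $|a_n-b_n|\le K(\varepsilon)$ for all $n\in\mathbb{N}$. Since any $\{a_n\}$ admissible for $\varepsilon$ is admissible for every larger $\varepsilon$, the failure of this property is equivalent to the explicit form in the claim. *)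

(* Defs.v *)
From Stdlib Require Import Reals.
From Coquelicot Require Import Coquelicot.

(* The Riemann sphere; [None] is the point at infinity. *)
Definition sphere : Type := option C.
Definition infty : sphere := None.

Definition mobius (a b c d : C) (z : sphere) : sphere :=
  match z with
  | Some z =>
      if Ceq_dec (c * z + d)%C 0%C then infty
      else Some ((a * z + b) / (c * z + d))%C
  | None => if Ceq_dec c 0%C then infty else Some (a / c)%C
  end.

(* |z - w|, with the convention that it is +oo when w is the point at infinity. *)
Definition edist (z : C) (w : sphere) : Rbar :=
  match w with
  | Some w => Finite (Cmod (z - w)%C)
  | None => p_infty
  end.

(* The orbit starts in C but is computed on the sphere, so it may pass
   through infinity later on. *)
Definition is_solution (g : sphere -> sphere) (v : nat -> sphere) : Prop :=
  v 0%nat <> infty /\ forall n : nat, v (S n) = g (v n).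

Definition is_approx_solution
  (g : sphere -> sphere) (eps : R) (u : nat -> C) : Prop :=
  forall n : nat,
    g (Some (u n)) <> infty /\
    Rbar_le (edist (u (S n)) (g (Some (u n)))) (Finite eps).

(* The distance bound is only required from index 1 on. *)
Definition hyers_ulam_stable (g : sphere -> sphere) : Prop :=
  exists K : R -> R,
    filterlim K (at_right 0) (locally 0%R) /\
    forall eps : R, (0 < eps)%R ->
    forall u : nat -> C, is_approx_solution g eps u ->
    exists v : nat -> sphere, is_solution g v /\
      forall n : nat, (1 <= n)%nat ->
        Rbar_le (edist (u n) (v n)) (Finite (K eps)).

(* Main.v *)
Require Import Defs.
From Stdlib Require Import Reals Lra Lia.
From Coquelicot Require Import Coquelicot.

(** Suppose first that c <> 0. A parabolic map g then has a single fixed point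
    p, which is finite, and with s = (a + d) / 2 = ±1 the coordinate
    w = 1 / (s c (z - p)) turns g into the translation w |-> w + 1. In this
    coordinate p is w = infinity and z = infinity is w = 0, so every orbit of g
    converges to p ([parabolic_orbit_attracted]), possibly after one visit to
    infinity. A neighbourhood of w = infinity is a small disc about p, however,
    so a perturbation of size eps can carry a point with w far out on the
    positive axis to one far out on the negative axis. Repeating this jump gives
    a periodic approximate solution: w climbs from - M + 1/2 to M - 1/2 in unit
    steps and then falls back, where M is of order 1 / (|c| eps). It takes half
    integer values, so the pole w = 0 is avoided, and it passes through w = 1/2,
    at distance 2 / |c| from p, once in every period. No true orbit can follow
    it within 1 / |c|: see [parabolic_separated].

    If c = 0 then a = d and g is the translation z |-> z + b / a, possibly the
    identity; adding eps at each step makes the approximate solution drift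
    linearly away from every orbit: see [translation_separated].

    In both cases the separation delta does not depend on eps, which
    contradicts a bound K(eps) tending to 0: see [separated_not_stable]. *)

Local Open Scope R_scope.

(** * Separation and Hyers-Ulam stability *)

Definition orbits_separated (g : sphere -> sphere) (delta : R) : Prop :=
  forall eps : R, 0 < eps ->
  exists u : nat -> C,
    is_approx_solution g eps u /\
    forall v : nat -> sphere, is_solution g v ->
    exists n : nat, (1 <= n)%nat /\ Rbar_lt (Finite delta) (edist (u n) (v n)).

(** A stability bound K would satisfy K(eps) < delta at some small eps, and for
    this eps both conclusions apply to the same approximate solution. *)
Lemma separated_not_stable (g : sphere -> sphere) (delta : R) :
  0 < delta -> orbits_separated g delta -> ~ hyers_ulam_stable g.
Proof.
intros Hdelta Hsep [K [HK Hstab]].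
destruct (HK (ball 0 delta)) as [r Hr].
{ exists (mkposreal delta Hdelta); auto. }
pose proof (cond_pos r) as Hr0.
assert (HKd : K (r / 2) < delta).
{ assert (Hb : ball 0 delta (K (r / 2))).
  { apply Hr; [|lra].
    change (Rabs (r / 2 - 0) < r). rewrite Rabs_pos_eq; lra. }
  change (Rabs (K (r / 2) - 0) < delta) in Hb.
  apply Rabs_def2 in Hb. lra. }
destruct (Hsep (r / 2)) as [u [Hu Hfar]]; [lra|].
destruct (Hstab (r / 2) ltac:(lra) u Hu) as [v [Hv Hclose]].
destruct (Hfar v Hv) as [n [Hn Hlt]].
specialize (Hclose n Hn).
apply (Rbar_lt_not_le _ _ Hlt).
apply Rbar_le_trans with (1 := Hclose). simpl. lra.
Qed.

(** * The case c = 0 *)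

Lemma mobius_translation (a b z : C) :
  a <> 0%C -> mobius a b 0 a (Some z) = Some (z + b / a)%C.
Proof.
intros Ha. unfold mobius.
destruct (Ceq_dec (0 * z + a)%C 0%C) as [E|_].
- exfalso. apply Ha. rewrite <- E. ring.
- f_equal. field. exact Ha.
Qed.

(** Along the perturbed orbit a_n = n (b / a + eps), the difference from the orbit
    of z is n eps - z, which is unbounded. *)
Lemma translation_separated (a b : C) :
  a <> 0%C -> orbits_separated (mobius a b 0 a) 1.
Proof.
intros Ha eps Heps.
exists (fun n => RtoC (INR n) * (b / a + RtoC eps))%C. split.
- intros n. rewrite mobius_translation by exact Ha. split; [discriminate|].
  cbv [edist Rbar_le]. rewrite S_INR, RtoC_plus.
  match goal with |- Cmod ?x <= _ => replace x with (RtoC eps) by ring end.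
  rewrite Cmod_R, Rabs_pos_eq; lra.
- intros v [Hv0 Hv].
  destruct (v O) as [z|] eqn:Ez; [|now destruct Hv0].
  assert (Hvn : forall n, v n = Some (z + RtoC (INR n) * (b / a))%C).
  { induction n as [|n IH].
    - rewrite Ez. f_equal. simpl. ring.
    - rewrite Hv, IH, mobius_translation by exact Ha.
      rewrite S_INR, RtoC_plus. f_equal. ring. }
  destruct (INR_unbounded ((Cmod z + 1) / eps)) as [n Hn].
  assert (Hneps : Cmod z + 1 < INR n * eps).
  { apply Rmult_lt_compat_r with (r := eps) in Hn; [|lra].
    unfold Rdiv in Hn. rewrite Rmult_assoc, Rinv_l in Hn; lra. }
  pose proof (Cmod_ge_0 z) as Hz.
  exists n. split.
  + destruct n; [simpl in Hneps; lra|lia].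
  + rewrite Hvn. simpl.
    match goal with |- _ < Cmod ?x =>
      replace x with (RtoC (INR n * eps) - z)%C by (rewrite RtoC_mult; ring) end.
    pose proof (Cmod_triangle (RtoC (INR n * eps) - z) z) as Ht.
    replace (RtoC (INR n * eps) - z + z)%C with (RtoC (INR n * eps)) in Ht by ring.
    rewrite Cmod_R, Rabs_pos_eq in Ht; lra.
Qed.

(** * The linearizing coordinate at the fixed point *)

(** The point with coordinate w, that is, the inverse of
    z |-> 1 / (k (z - p)); the point p itself, where w would be infinite, is not
    in its range. *)
Definition chart (k p w : C) : sphere :=
  if Ceq_dec w 0%C then infty else Some (p + / (k * w))%C.

Lemma chart_finite (k p w : C) :
  w <> 0%C -> chart k p w = Some (p + / (k * w))%C.
Proof.
intros Hw. unfold chart. now destruct (Ceq_dec w 0%C).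
Qed.

(** The general shape of a matrix with c <> 0, determinant s^2 and trace 2 s:
    its fixed point p replaces a, b and d as parameter. *)
Definition parabolic (s c p : C) : sphere -> sphere :=
  mobius (s + c * p) (- (c * p * p)) c (s - c * p).

Lemma sign_neq0 (s : C) : s = RtoC 1 \/ s = RtoC (-1) -> s <> 0%C.
Proof.
intros [E|E] E0; rewrite E in E0; apply RtoC_inj in E0; lra.
Qed.

(** In terms of t = z - p the map is t |-> s t / (c t + s), so the reciprocal of
    s c t grows by 1 / s^2 = 1 at each step. The equation holds at the pole
    w = -1 and at w = 0 (z = infinity) as well. *)
Lemma parabolic_chart (s c p w : C) :
  s = RtoC 1 \/ s = RtoC (-1) -> c <> 0%C ->
  parabolic s c p (chart (s * c) p w) = chart (s * c) p (w + 1)%C.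
Proof.
intros Hs Hc.
assert (Hss : (s * s)%C = 1%C).
{ destruct Hs; subst s; rewrite <- RtoC_mult; f_equal; ring. }
pose proof (sign_neq0 s Hs) as Hs0.
(* As s = 1 / s, an s can be moved to the numerator, where [field] needs no
   relation between its atoms. *)
assert (Hinv : forall x : C, x <> 0%C -> (/ (s * c * x) = s / (c * x))%C).
{ intros x Hx. replace (s / (c * x))%C with ((s * s) / (s * c * x))%C.
  - rewrite Hss. field. auto.
  - field. auto. }
unfold parabolic, chart, mobius.
destruct (Ceq_dec w 0%C) as [Ew|Hw].
- destruct (Ceq_dec c 0%C) as [Ec|_]; [contradiction|].
  rewrite Ew, Cplus_0_l.
  destruct (Ceq_dec 1%C 0%C) as [E|_]; [now destruct C1_nz|].
  unfold infty. f_equal. rewrite (Hinv 1%C C1_nz). field. exact Hc.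
- rewrite (Hinv w Hw).
  assert (Hden : (c * (p + s / (c * w)) + (s - c * p) = s * (w + 1) / w)%C).
  { field. auto. }
  rewrite Hden.
  destruct (Ceq_dec (w + 1)%C 0%C) as [E|H1].
  + destruct Ceq_dec as [_|N]; [reflexivity|].
    exfalso. apply N. rewrite E. field. exact Hw.
  + destruct Ceq_dec as [E|_].
    * exfalso. revert E. repeat apply Cmult_neq_0; auto.
      intros E. apply C1_nz. rewrite <- (Cinv_r w Hw), E. ring.
    * f_equal. rewrite (Hinv _ H1).
      replace ((s + c * p) * (p + s / (c * w)) + - (c * p * p))%C
        with (s * p + s * s / (c * w) + s * p / w)%C.
      -- field. auto.
      -- field. auto.
Qed.

Lemma parabolic_fixed_point (s c p : C) :
  s <> 0%C -> parabolic s c p (Some p) = Some p.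
Proof.
intros Hs. unfold parabolic, mobius.
replace (c * p + (s - c * p))%C with s by ring.
destruct (Ceq_dec s 0%C) as [E|_]; [contradiction|].
f_equal. field. exact Hs.
Qed.

Lemma chart_near_fixed_point (k p w : C) :
  k <> 0%C -> 1 < Cmod w ->
  exists z, chart k p w = Some z /\ Cmod (z - p) < / Cmod k.
Proof.
intros Hk Hw.
assert (Hw0 : w <> 0%C) by (apply Cmod_gt_0; lra).
apply Cmod_gt_0 in Hk as Hk'.
exists (p + / (k * w))%C. split; [now apply chart_finite|].
replace (p + / (k * w) - p)%C with (/ (k * w))%C by ring.
rewrite Cmod_inv, Cmod_mult by now apply Cmult_neq_0.
apply Rinv_lt_contravar.
- apply Rmult_lt_0_compat; [|apply Rmult_lt_0_compat]; lra.
- assert (H := Rmult_lt_compat_l _ _ _ Hk' Hw). lra.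
Qed.

(** Every orbit converges to p; only the bound needed below is recorded. An orbit
    not starting at p has coordinates w0 + n, and |w0 + n| > 1 as soon as
    n > |w0| + 1, which also puts the orbit past its visit to infinity. *)
Lemma parabolic_orbit_attracted (s c p : C) (v : nat -> sphere) :
  s = RtoC 1 \/ s = RtoC (-1) -> c <> 0%C -> is_solution (parabolic s c p) v ->
  exists N : nat, forall n : nat, (N <= n)%nat ->
    exists z, v n = Some z /\ Cmod (z - p) < / Cmod (s * c).
Proof.
intros Hs Hc [Hv0 Hv].
pose proof (sign_neq0 s Hs) as Hs0.
pose proof (Cmult_neq_0 _ _ Hs0 Hc) as Hk.
destruct (v O) as [z0|] eqn:Ez; [|now destruct Hv0].
destruct (Ceq_dec z0 p) as [Ep|Hp].
- exists O. intros n _. exists p. split.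
  + induction n as [|n IH]; [now rewrite Ez, Ep|].
    now rewrite Hv, IH, parabolic_fixed_point.
  + unfold Cminus. rewrite Cplus_opp_r, Cmod_0.
    apply Rinv_0_lt_compat. now apply Cmod_gt_0.
- set (w0 := (/ (s * c * (z0 - p)))%C).
  assert (Hp' : (z0 - p)%C <> 0%C) by now apply Cminus_eq_contra.
  assert (Hw0 : w0 <> 0%C).
  { intros E. apply C1_nz.
    rewrite <- (Cinv_r _ (Cmult_neq_0 _ _ Hk Hp')). fold w0. rewrite E. ring. }
  assert (Hvn : forall n, v n = chart (s * c) p (w0 + RtoC (INR n))%C).
  { induction n as [|n IH].
    - simpl INR. rewrite Cplus_0_r, Ez, chart_finite by exact Hw0.
      f_equal. unfold w0. field. auto.
    - rewrite Hv, IH, parabolic_chart, S_INR, RtoC_plus by assumption.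
      f_equal. ring. }
  destruct (INR_unbounded (Cmod w0 + 1)) as [N HN].
  exists N. intros n Hn. rewrite Hvn. apply chart_near_fixed_point; [exact Hk|].
  apply le_INR in Hn.
  pose proof (Cmod_triangle (w0 + RtoC (INR n)) (- w0)) as Ht.
  replace (w0 + RtoC (INR n) + - w0)%C with (RtoC (INR n)) in Ht by ring.
  pose proof (Cmod_ge_0 w0).
  rewrite Cmod_opp, Cmod_R, Rabs_pos_eq in Ht; lra.
Qed.

(** * The periodic approximate solution *)

(** Climbs from - M + 1/2 to M - 1/2 in unit steps, with period 2 M. *)
Definition sawtooth (M n : nat) : R := INR (n mod (2 * M)) - INR M + / 2.

Lemma half_integer_neq0 (m n : nat) : INR m - INR n + / 2 <> 0.
Proof.
intros E.
assert (E2 : INR (2 * m + 1) = INR (2 * n)).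
{ rewrite plus_INR, !mult_INR. simpl. lra. }
apply INR_eq in E2. lia.
Qed.

Lemma sawtooth_step (M n : nat) :
  (1 <= M)%nat ->
  sawtooth M (S n) = sawtooth M n + 1 \/
  (sawtooth M n = INR M - / 2 /\ sawtooth M (S n) = - INR M + / 2).
Proof.
intros HM. unfold sawtooth.
pose proof (Nat.mod_upper_bound n (2 * M) ltac:(lia)) as Hlt.
pose proof (Nat.div_mod_eq n (2 * M)) as Hdm.
destruct (Nat.eq_dec (S (n mod (2 * M))) (2 * M)) as [E|N].
- right. split.
  + assert (H : INR (S (n mod (2 * M))) = INR (2 * M)) by now rewrite E.
    rewrite S_INR, mult_INR in H. simpl (INR 2) in H. lra.
  + replace (S n mod (2 * M))%nat with 0%nat; [simpl; lra|].
    apply (Nat.mod_unique _ _ (S (n / (2 * M)))); lia.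
- left.
  replace (S n mod (2 * M))%nat with (S (n mod (2 * M))).
  + rewrite S_INR. ring.
  + apply (Nat.mod_unique _ _ (n / (2 * M))); lia.
Qed.

Lemma sawtooth_half (M q : nat) :
  (1 <= M)%nat -> sawtooth M (M + q * (2 * M)) = / 2.
Proof.
intros HM. unfold sawtooth.
rewrite Nat.Div0.mod_add, Nat.mod_small by lia. ring.
Qed.

(** Near w = ± infinity the distance in z is measured by 1 / w, up to the factor
    1 / |s c|, so falling from M + 1/2 to - M + 1/2 costs only O(1 / M). *)
Lemma inv_jump_small (x : R) :
  1 <= x -> Rabs (/ (- x + / 2) - / (x - / 2 + 1)) <= 4 * / x.
Proof.
intros Hx.
replace (- x + / 2) with (- (x - / 2)) by ring.
rewrite Rinv_opp.
assert (B1 : / (x - / 2) <= / (x / 2)) by (apply Rinv_le_contravar; lra).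
assert (B2 : / (x - / 2 + 1) <= / (x / 2)) by (apply Rinv_le_contravar; lra).
assert (P1 : 0 < / (x - / 2)) by (apply Rinv_0_lt_compat; lra).
assert (P2 : 0 < / (x - / 2 + 1)) by (apply Rinv_0_lt_compat; lra).
replace (/ (x / 2)) with (2 * / x) in B1, B2 by (field; lra).
rewrite Rabs_left; lra.
Qed.

(** The approximate solution returns to distance 2 / |s c| from p (at w = 1/2)
    at arbitrarily late times, when the orbit is already within 1 / |s c| of p. *)
Lemma parabolic_separated (s c p : C) :
  s = RtoC 1 \/ s = RtoC (-1) -> c <> 0%C ->
  orbits_separated (parabolic s c p) (/ Cmod (s * c)).
Proof.
intros Hs Hc eps Heps.
pose proof (Cmult_neq_0 _ _ (sign_neq0 s Hs) Hc) as Hk.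
assert (HkR : 0 < Cmod (s * c)) by now apply Cmod_gt_0.
assert (Hkinv : 0 < / Cmod (s * c)) by now apply Rinv_0_lt_compat.
(* The jump costs at most 4 / (|s c| M); the summand 1 ensures M >= 1. *)
destruct (INR_unbounded (1 + 4 * / Cmod (s * c) / eps)) as [M HM].
assert (Hq : 0 < / Cmod (s * c) / eps) by now apply Rdiv_lt_0_compat.
assert (HM1 : (1 <= M)%nat).
{ apply INR_le. simpl. lra. }
assert (HMeps : / Cmod (s * c) * 4 < INR M * eps).
{ assert (H : (4 * / Cmod (s * c) / eps) * eps < INR M * eps)
    by (apply Rmult_lt_compat_r; lra).
  unfold Rdiv in H. rewrite Rmult_assoc, Rinv_l in H; lra. }
assert (Hne : forall n, RtoC (sawtooth M n) <> 0%C).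
{ intros n E. apply RtoC_inj in E. now apply (half_integer_neq0 _ _ E). }
assert (Hne1 : forall n, (RtoC (sawtooth M n) + 1)%C <> 0%C).
{ intros n E. rewrite <- RtoC_plus in E. apply RtoC_inj in E.
  apply (half_integer_neq0 (S (n mod (2 * M))) M).
  rewrite S_INR. unfold sawtooth in E. lra. }
exists (fun n => p + / (s * c * RtoC (sawtooth M n)))%C. split.
- intros n. rewrite <- chart_finite, parabolic_chart, chart_finite by auto.
  split; [discriminate|]. cbv [edist Rbar_le].
  destruct (sawtooth_step M n HM1) as [E|[E1 E2]].
  + rewrite E, RtoC_plus.
    unfold Cminus. rewrite Cplus_opp_r, Cmod_0. lra.
  + rewrite E1, E2. rewrite <- RtoC_plus.
    assert (HMR : 1 <= INR M) by (apply (le_INR 1); exact HM1).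
    match goal with |- Cmod ?x <= _ =>
      replace x with (/ (s * c) * RtoC (/ (- INR M + / 2) - / (INR M - / 2 + 1)))%C end.
    2:{ rewrite RtoC_minus, !RtoC_inv by lra.
        field. repeat split; try (intros E; apply RtoC_inj in E; lra).
        - exact Hc.
        - now apply sign_neq0. }
    rewrite Cmod_mult, Cmod_inv, Cmod_R by exact Hk.
    pose proof (inv_jump_small (INR M) HMR) as Hr.
    apply Rle_trans with (/ Cmod (s * c) * (4 * / INR M)).
    { apply Rmult_le_compat_l; lra. }
    apply Rmult_le_reg_r with (INR M); [lra|].
    replace (/ Cmod (s * c) * (4 * / INR M) * INR M)
      with (/ Cmod (s * c) * 4) by (field; lra).
    lra.
- intros v Hv.
  destruct (parabolic_orbit_attracted s c p v Hs Hc Hv) as [N HN].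
  (* N periods are added to reach a time after N at which w = 1/2. *)
  exists (M + N * (2 * M))%nat. split; [lia|].
  destruct (HN (M + N * (2 * M))%nat) as [z [Ez Hz]]; [nia|].
  rewrite Ez, sawtooth_half by exact HM1. simpl.
  set (x := (/ (s * c * RtoC (/ 2)))%C).
  assert (Hx : Cmod x = 2 * / Cmod (s * c)).
  { unfold x. rewrite Cmod_inv, Cmod_mult, Cmod_R, Rabs_pos_eq.
    - field. lra.
    - lra.
    - apply Cmult_neq_0; [exact Hk|]. intros E; apply RtoC_inj in E; lra. }
  pose proof (Cmod_triangle (p + x - z) (z - p)) as Ht.
  replace (p + x - z + (z - p))%C with x in Ht by ring. lra.
Qed.

(** * Normal forms and conclusion *)

(** Half the trace is s, and p = (a - s) / c is the double root of the fixed
    point equation c z^2 + (d - a) z - b = 0, whose discriminant (a + d)^2 - 4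
    vanishes. *)
Lemma parabolic_form (a b c d : C) :
  (a * d - b * c)%C = RtoC 1 ->
  (a + d)%C = RtoC 2 \/ (a + d)%C = RtoC (-2) -> c <> 0%C ->
  exists s p : C, (s = RtoC 1 \/ s = RtoC (-1)) /\
    mobius a b c d = parabolic s c p.
Proof.
intros Hdet Htr Hc.
assert (Hs : exists s, (s = RtoC 1 \/ s = RtoC (-1)) /\ (s * s = 1)%C /\ d = (s + s - a)%C).
{ destruct Htr as [H|H]; [exists (RtoC 1)|exists (RtoC (-1))];
    (split; [auto|split]);
    try (rewrite <- RtoC_mult; f_equal; ring);
    rewrite <- RtoC_plus; replace d with (a + d - a)%C by ring; rewrite H;
    do 2 f_equal; ring. }
destruct Hs as [s [Hs [Hss Hd]]].
exists s, ((a - s) / c)%C. split; [exact Hs|].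
unfold parabolic. f_equal.
- field. exact Hc.
- assert (Hb : (b * c)%C = (a * d - s * s)%C).
  { rewrite Hss, <- Hdet. ring. }
  replace b with (b * c / c)%C by (field; exact Hc).
  rewrite Hb, Hd. field. exact Hc.
- rewrite Hd. field. exact Hc.
Qed.

(** (a - d)^2 = (a + d)^2 - 4 a d = 0. *)
Lemma equal_diagonal (a d : C) :
  (a * d)%C = RtoC 1 ->
  (a + d)%C = RtoC 2 \/ (a + d)%C = RtoC (-2) -> a = d /\ a <> 0%C.
Proof.
intros Hdet Htr. split.
- destruct (Ceq_dec a d) as [E|N]; [exact E|]. exfalso.
  apply Cminus_eq_contra in N. apply (Cmult_neq_0 _ _ N N).
  replace ((a - d) * (a - d))%C with ((a + d) * (a + d) - 4 * (a * d))%C by ring.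
  rewrite Hdet. destruct Htr as [H|H]; rewrite H; ring.
- intros E. rewrite E, Cmult_0_l in Hdet. apply C1_nz. now symmetry.
Qed.

Theorem theorem4p3 :
  forall a b c d : C,
    (a * d - b * c)%C = RtoC 1 ->
    (a + d)%C = RtoC 2 \/ (a + d)%C = RtoC (-2) ->
    ~ hyers_ulam_stable (mobius a b c d) /\
    exists delta : R, (0 < delta)%R /\
      forall eps : R, (0 < eps)%R ->
      exists u : nat -> C,
        is_approx_solution (mobius a b c d) eps u /\
        forall v : nat -> sphere, is_solution (mobius a b c d) v ->
        exists n : nat, (1 <= n)%nat /\
          Rbar_lt (Finite delta) (edist (u n) (v n)).
Proof.
intros a b c d Hdet Htr.
assert (H : exists delta, 0 < delta /\ orbits_separated (mobius a b c d) delta).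
{ destruct (Ceq_dec c 0%C) as [Ec|Hc].
  - subst c. destruct (equal_diagonal a d) as [Ed Ha]; [|exact Htr|].
    + rewrite <- Hdet. ring.
    + subst d. exists 1. split; [lra|]. now apply translation_separated.
  - destruct (parabolic_form a b c d Hdet Htr Hc) as [s [p [Hs Eg]]].
    exists (/ Cmod (s * c)). rewrite Eg. split.
    + apply Rinv_0_lt_compat, Cmod_gt_0, Cmult_neq_0; [now apply sign_neq0|exact Hc].
    + now apply parabolic_separated. }
destruct H as [delta [Hdelta Hsep]]. split.
- now apply separated_not_stable with delta.
- now exists delta.
Qed.
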